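(* Let $M$ be a smooth $n$-dimensional manifold, let $\mathcal{J}$ be an adapted almost tangent structure on $T^{*}M\setminus\{0\}$, let $\rho$ be a $\mathcal{J}$-regular vector field, and let $\mathcal{N}=-\mathcal{L}_\rho\mathcal{J}$ be the canonical nonlinear connection, with projectors $h,v$. Let $\nabla$ be the dynamical covariant derivative with respect to $\rho$ and $\mathcal{N}$, and let $\mathcal{D}$ be the Berwald linear connection induced by $\mathcal{N}$. If $\rho$ is horizontal (i.e. $h\rho=\rho$, $v\rho=0$), then $$\nabla=\mathcal{D}_\rho .$$
   Context: All structures are smooth on $T^{*}M\setminus\{0\}$ (zero section removed), with induced local coordinates $(x^i,p_i)$. The vertical distribution $VT^{*}M$ is spanned locally by $\partial/\partial p_i$. Nonlinear connection: a $(1,1)$-tensor field $\mathcal{N}$ with $\mathcal{N}^2=\mathrm{Id}$ and $\ker(\mathrm{Id}+\mathcal{N})=VT^{*}M$; its projectors are $h=\frac12(\mathrm{Id}+\mathcal{N})$ and $v=\frac12(\mathrm{Id}-\mathcal{N})$. Adapted almost tangent structure: a $(1,1)$-tensor field $\mathcal{J}$ of rank $n$ with $\mathcal{J}^2=0$ and $\operatorname{Im}\mathcal{J}=\ker\mathcal{J}=VT^{*}M$; locally $\mathcal{J}=t_{ij}\,dx^i\otimes\frac{\partial}{\partial p_j}$, meaning $\mathcal{J}(\partial/\partial x^i)=t_{ij}\,\partial/\partial p_j$ and $\mathcal{J}(\partial/\partial p_i)=0$. A vector field $\rho$ is $\mathcal{J}$-regular if $\mathcal{J}[\rho,\mathcal{J}X]=-\mathcal{J}X$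 for all vector fields $X$. For a $(1,1)$-tensor field $L$, $(\mathcal{L}_\rho L)(X)=[\rho,LX]-L[\rho,X]$. For $\rho$ $\mathcal{J}$-regular, $-\mathcal{L}_\rho\mathcal{J}$ is a nonlinear connection. Dynamical covariant derivative: $\nabla f=\rho(f)$ on functions and $\nabla X=h[\rho,hX]+v[\rho,vX]$ on vector fields, extended to all tensor fields as a type-preserving derivation commuting with contractions. Berwald linear connection: with $\mathbb{F}=h\circ\mathcal{L}_\rho h-\mathcal{J}$, $$\mathcal{D}_XY=v[hX,vY]+h[vX,hY]+\mathcal{J}[vX,(\mathbb{F}+\mathcal{J})Y]+(\mathbb{F}+\mathcal{J})[hX,\mathcal{J}Y],$$ extended to tensor fields in the usual way (with $\mathcal{D}_Xf=X(f)$). *)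

(* Defs.v *)
From HB Require Import structures.
From mathcomp Require Import all_boot all_order all_algebra.
From mathcomp Require Import all_classical all_reals all_analysis.
From mathcomp Require Import ring.
Import Order.TTheory GRing.Theory Num.Theory.
Import numFieldNormedType.Exports.

Set Implicit Arguments.
Unset Strict Implicit.
Unset Printing Implicit Defensive.

Local Open Scope classical_set_scope.
Local Open Scope ring_scope.

Section SmoothOn.
Variables (R : realType) (m : nat).
Implicit Types (U : set 'rV[R]_m) (f g : 'rV[R]_m -> R).

Definition partial (j : 'I_m) f : 'rV[R]_m -> R :=
  fun z => 'D_(delta_mx 0 j : 'rV[R]_m) f z.

(* class C^k on an open set U, by iterated partial derivatives *)
Fixpoint Ck (k : nat) U f : Prop :=
  (forall z, U z -> {for z, continuous f}) /\
  match k with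
  | 0 => True
  | k'.+1 => forall j, (forall z, U z -> derivable f z (delta_mx 0 j)) /\
                       Ck k' U (partial j f)
  end.

Lemma Ck_continuous k U f z : Ck k U f -> U z -> {for z, continuous f}.
Proof. by case: k => [|k] [cf _]; exact: cf. Qed.

Lemma Ck_pred k U f : Ck k.+1 U f -> Ck k U f.
Proof.
elim: k f => [|k IH] f [cf df]; split=> // j.
by have [dfj Cfj] := df j; split=> //; exact: IH.
Qed.

Lemma open_near_ext U f g z : open U -> U z -> (forall y, U y -> f y = g y) ->
  \forall y \near z, f y = g y.
Proof.
move=> oU Uz fg; have : nbhs z U by exact: open_nbhs_nbhs.
by apply: filterS => y; exact: fg.
Qed.

Lemma Ck_ext k U f g : open U -> (forall z, U z -> f z = g z) ->
  Ck k U f -> Ck k U g.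
Proof.
move=> oU; have cfg f' g' : (forall z, U z -> f' z = g' z) ->
    (forall z, U z -> {for z, continuous f'}) ->
    forall z, U z -> {for z, continuous g'}.
  move=> fg cf z Uz; rewrite /prop_for /continuous_at -fg//.
  apply: cvg_trans (cf _ Uz); apply: near_eq_cvg; first exact: (nbhs_filter z).
  by apply: (open_near_ext oU Uz) => y Uy; rewrite fg.
elim: k f g => [|k IH] f g fg [cf Cf]; split=> //; try exact: cfg cf.
move=> j; case: (Cf j) => df Cdf; split=> [z Uz|].
  exact: near_eq_derivable (open_near_ext oU Uz fg) (df _ Uz).
apply: IH Cdf => z Uz.
exact: near_eq_derive (open_near_ext oU Uz fg).
Qed.

Lemma Ck_cst k U (a : R) : Ck k U (cst a).
Proof.
elim: k a => [|k IH] a; split=> //; try by move=> z _; exact: cst_continuous.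
move=> j; split=> [z _|]; first exact: derivable_cst.
have -> : partial j (cst a) = cst 0 by apply/funext=> z; exact: derive_cst.
exact: IH.
Qed.

Lemma CkD k U f g : open U -> Ck k U f -> Ck k U g -> Ck k U (f + g).
Proof.
move=> oU; elim: k f g => [|k IH] f g Cf Cg; split=> //;
  try by move=> z Uz; exact: cvgD (Ck_continuous Cf Uz) (Ck_continuous Cg Uz).
move=> j.
case: Cf Cg => _ /(_ j) [df Cf] [_ /(_ j) [dg Cg]].
split=> [z Uz|]; first by apply: derivableD; [exact: df|exact: dg].
apply: (@Ck_ext _ _ (partial j f + partial j g)) => // [z Uz|].
  by rewrite /partial deriveD//; [exact: df|exact: dg].
exact: IH.
Qed.

Lemma CkM k U f g : open U -> Ck k U f -> Ck k U g -> Ck k U (f * g).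
Proof.
move=> oU; elim: k f g => [|k IH] f g Cf Cg; split=> //;
  try by move=> z Uz; exact: cvgM (Ck_continuous Cf Uz) (Ck_continuous Cg Uz).
move=> j.
have Cf' := Ck_pred Cf; have Cg' := Ck_pred Cg.
case: Cf Cg => _ /(_ j) [df Cf] [_ /(_ j) [dg Cg]].
split=> [z Uz|]; first by apply: derivableM; [exact: df|exact: dg].
apply: (@Ck_ext _ _ (f * partial j g + g * partial j f)) => // [z Uz|].
  by rewrite /partial deriveM//; [exact: df|exact: dg].
by apply: CkD => //; exact: IH.
Qed.

(* For open U, where U° = U, this is smoothness on U.  The chart images of a
   manifold are open; the interior is there only so that smooth functions form
   a ring before one knows that the chart images are open. *)
Definition smooth_on U f := forall k, Ck k U° f.

Lemma smooth_on_ext U f g : (forall z, U z -> f z = g z) ->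
  smooth_on U f -> smooth_on U g.
Proof.
move=> fg Uf k; apply: Ck_ext (Uf k); first exact: open_interior.
by move=> z /interior_subset; exact: fg.
Qed.

Lemma smooth_on_cst U (a : R) : smooth_on U (cst a).
Proof. by move=> k; exact: Ck_cst. Qed.

Lemma smooth_onD U f g : smooth_on U f -> smooth_on U g -> smooth_on U (f + g).
Proof. by move=> Uf Ug k; apply: CkD; first exact: open_interior. Qed.

Lemma smooth_onM U f g : smooth_on U f -> smooth_on U g -> smooth_on U (f * g).
Proof. by move=> Uf Ug k; apply: CkM; first exact: open_interior. Qed.

End SmoothOn.

(* A set with coordinate systems modelled on R^m.  The charts carry the
   topology: a set is open when all its coordinate images are. *)

Record charted (R : realType) (m : nat) := Charted {
  point_of :> Type;
  cidx : Type;
  cdom : cidx -> set point_of;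
  cmap : cidx -> point_of -> 'rV[R]_m }.
Arguments cdom {R m N} c : rename.
Arguments cmap {R m N} c x : rename.

Section Charted.
Variables (R : realType) (m : nat) (N : charted R m).
Implicit Types (c : cidx N) (f g : N -> R) (O : set N).

Definition cimage c O : set 'rV[R]_m := cmap c @` (cdom c `&` O).

(* f \o (cmap c)^-1 on the image of the chart, and 0 elsewhere *)
Definition local_rep c f : 'rV[R]_m -> R := fun z =>
  match pselect (exists2 x, cdom c x & cmap c x = z) with
  | left h => f (s2val (cid2 h))
  | right _ => 0
  end.

Definition copen O := forall c, open (cimage c O).

Definition smooth f := forall c, smooth_on (cimage c setT) (local_rep c f).

Definition is_manifold : Prop :=
  [/\ (forall x, exists c, cdom c x),
      (forall c, {in cdom c &, injective (cmap c)}),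
      (forall c c', open (cimage c (cdom c'))) &
      (forall c c' (k : 'I_m), smooth_on (cimage c (cdom c'))
         (local_rep c (fun x => cmap c' x 0 k)))] /\
  [/\ (forall x y : N, x <> y ->
         exists O O', [/\ copen O, copen O', O x, O' y & O `&` O' = set0]) &
      (exists B : nat -> set N, (forall i, copen (B i)) /\
         forall O x, copen O -> O x -> exists i, B i x /\ B i `<=` O)].

End Charted.

Record manifold (R : realType) (m : nat) := Manifold {
  charts_of :> charted R m;
  manifoldP : is_manifold charts_of }.


Section SmoothFunctions.
Variables (R : realType) (m : nat) (N : charted R m).
Implicit Types (c : cidx N) (f g : N -> R).

Lemma local_repD c f g : local_rep c (f + g) = local_rep c f + local_rep c g.
Proof.
apply/funext=> z; rewrite /local_rep /GRing.add /=.
by case: pselect => // _; rewrite addr0.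
Qed.

Lemma local_repM c f g : local_rep c (f * g) = local_rep c f * local_rep c g.
Proof.
apply/funext=> z; rewrite /local_rep /GRing.mul /=.
by case: pselect => // _; rewrite mulr0.
Qed.

Lemma local_rep_cst c a z : cimage c setT z -> local_rep c (cst a : N -> R) z = a.
Proof. by case=> x [cx _] xz; rewrite /local_rep; case: pselect => // -[]; exists x. Qed.

Lemma smooth_cst a : smooth (cst a : N -> R).
Proof.
move=> c; apply: smooth_on_ext (smooth_on_cst _ a) => z cz.
by rewrite local_rep_cst.
Qed.

Lemma smoothD f g : smooth f -> smooth g -> smooth (f + g).
Proof. by move=> sf sg c; rewrite local_repD; exact: smooth_onD. Qed.

Lemma smoothM f g : smooth f -> smooth g -> smooth (f * g).
Proof. by move=> sf sg c; rewrite local_repM; exact: smooth_onM. Qed.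

Definition smooth_pred : pred (N -> R) := fun f => `[< smooth f >].

Lemma smooth_pred_subring : subring_closed smooth_pred.
Proof.
split=> [|f g /asboolP sf /asboolP sg|f g /asboolP sf /asboolP sg].
- by apply/asboolP; exact: smooth_cst.
- apply/asboolP; rewrite -mulN1r; apply: smoothD => //.
  by apply: smoothM => //; exact: (smooth_cst (-1)).
- by apply/asboolP; exact: smoothM.
Qed.

End SmoothFunctions.

Record smooth_fun (R : realType) (m : nat) (N : charted R m) := SmoothFun {
  smooth_val :> N -> R;
  smooth_valP : smooth_pred smooth_val }.
Notation "'C^oo' N" := (smooth_fun N) (at level 10, N at level 8, format "'C^oo'  N").

Section SmoothFunRing.
Variables (R : realType) (m : nat) (N : charted R m).

HB.instance Definition _ := [isSub for @smooth_val R m N].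
HB.instance Definition _ := [Choice of C^oo N by <:].
HB.instance Definition _ :=
  GRing.SubChoice_isSubComPzRing.Build (N -> R) (@smooth_pred R m N) (C^oo N)
    (@smooth_pred_subring R m N).

Definition smooth_const (a : R) : C^oo N :=
  SmoothFun (asboolT (smooth_cst a) : smooth_pred _).

Definition smooth_scale (a : R) (f : C^oo N) : C^oo N := smooth_const a * f.

Lemma smooth_scaleA a b f :
  smooth_scale a (smooth_scale b f) = smooth_scale (a * b) f.
Proof. by apply/val_inj/funext=> u; rewrite /smooth_scale /= !fctE /= mulrA. Qed.

Lemma smooth_scale1 : left_id 1 smooth_scale.
Proof. by move=> f; apply/val_inj/funext=> u; exact: mul1r. Qed.

Lemma smooth_scaleDr : right_distributive smooth_scale +%R.
Proof. by move=> a f g; exact: mulrDr. Qed.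

Lemma smooth_scaleDl f : {morph smooth_scale^~ f : a b / a + b}.
Proof. by move=> a b; apply/val_inj/funext=> u; exact: mulrDl. Qed.

HB.instance Definition _ := GRing.Zmodule_isLmodule.Build R (C^oo N)
  smooth_scaleA smooth_scale1 smooth_scaleDr smooth_scaleDl.

Lemma smooth_scaleE a (f : C^oo N) u : (a *: f) u = a * f u.
Proof. by []. Qed.
Lemma smooth_addE (f g : C^oo N) u : (f + g) u = f u + g u.
Proof. by []. Qed.
Lemma smooth_mulE (f g : C^oo N) u : (f * g) u = f u * g u.
Proof. by []. Qed.

Lemma smooth_scaleAr a (f g : C^oo N) : f * (a *: g) = a *: (f * g).
Proof. exact: mulrCA. Qed.

End SmoothFunRing.

(* Tangent vectors at u are the R-linear derivations C^oo(N) -> R at u, and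
   smooth vector fields are the R-linear derivations of C^oo(N). *)
Section Tangent.
Variables (R : realType) (m : nat) (N : charted R m).

Definition point_derivation (u : N) : pred (C^oo N -> R^o) := fun w =>
  `[< (forall a f g, w (a *: f + g) = a * w f + w g) /\
      (forall f g, w (f * g) = f u * w g + g u * w f) >].

Lemma point_derivation_submod u : submod_closed (point_derivation u).
Proof.
split=> [|a v w /asboolP[lv Lv] /asboolP[lw Lw]].
  apply/asboolP; split=> [a f g|f g].
    by rewrite [RHS]addr0 mulr0.
  by rewrite !mulr0 addr0.
apply/asboolP; split=> [b f g|f g]; rewrite !fctE /= ?lv ?lw ?Lv ?Lw.
  rewrite /GRing.scale /=; ring.
rewrite /GRing.scale /=; ring.
Qed.

Record tangent (u : N) := Tangent {
  tangent_val :> C^oo N -> R^o;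
  tangent_valP : point_derivation u tangent_val }.

HB.instance Definition _ u := [isSub for @tangent_val u].
HB.instance Definition _ u := [Choice of tangent u by <:].
HB.instance Definition _ u := GRing.SubChoice_isSubLmodule.Build R
  (C^oo N -> R^o) (point_derivation u) (tangent u)
  (GRing.submod_closed_semi (@point_derivation_submod u)).

Definition derivation : pred (C^oo N -> C^oo N) := fun X =>
  `[< (forall (a : R) f g, X (a *: f + g) = a *: X f + X g) /\
      (forall f g, X (f * g) = f * X g + g * X f) >].

Lemma derivation_submod :
  submod_closed (derivation : pred (C^oo N -> (C^oo N)^o)).
Proof.
split=> [|h X Y /asboolP[lX LX] /asboolP[lY LY]].
  apply/asboolP; split=> [a f g|f g].
    by rewrite /GRing.zero/=/cst scaler0 addr0.
  by rewrite /GRing.zero/=/cst !mulr0 addr0.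
have hE f : (h *: X + Y) f = h * X f + Y f by [].
apply/asboolP; split=> [b f g|f g]; rewrite !hE ?lX ?lY ?LX ?LY.
  rewrite mulrDr !smooth_scaleAr scalerDr; ring.
ring.
Qed.

Record vfield := VField {
  vfield_val :> C^oo N -> C^oo N;
  vfield_valP : derivation vfield_val }.

HB.instance Definition _ :=
  [isSub of vfield for vfield_val : vfield -> (C^oo N -> (C^oo N)^o)].
HB.instance Definition _ := [Choice of vfield by <:].
HB.instance Definition _ := GRing.SubChoice_isSubLmodule.Build (C^oo N)
  (C^oo N -> (C^oo N)^o) (derivation : pred (C^oo N -> (C^oo N)^o)) vfield
  (GRing.submod_closed_semi derivation_submod).

Lemma vfield_linear (X : vfield) (a : R) f g : X (a *: f + g) = a *: X f + X g.
Proof. by have /asboolP[lX _] := vfield_valP X; exact: lX. Qed.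

Lemma vfield_leibniz (X : vfield) f g : X (f * g) = f * X g + g * X f.
Proof. by have /asboolP[_ LX] := vfield_valP X; exact: LX. Qed.

Lemma at_point_subproof (X : vfield) (u : N) :
  point_derivation u (fun f => X f u).
Proof.
apply/asboolP; split=> [a f g|f g]; first by rewrite vfield_linear.
by rewrite vfield_leibniz.
Qed.

Definition at_point (X : vfield) (u : N) : tangent u :=
  Tangent (at_point_subproof X u).

Lemma bracket_subproof (X Y : vfield) :
  derivation (fun f => X (Y f) - Y (X f)).
Proof.
have lD (Z : vfield) f g : Z (f + g) = Z f + Z g.
  by have := vfield_linear Z 1 f g; rewrite !scale1r.
apply/asboolP; split=> [a f g|f g].
  rewrite !vfield_linear scalerBr opprD addrACA //.
rewrite !vfield_leibniz !lD !vfield_leibniz; ring.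
Qed.

Definition bracket (X Y : vfield) : vfield := VField (bracket_subproof X Y).
Lemma vfield_addE (X Y : vfield) f : (X + Y) f = X f + Y f.
Proof. by []. Qed.
Lemma vfield_scaleE h (X : vfield) f : (h *: X) f = h * X f.
Proof. by []. Qed.
End Tangent.

Section CotangentBundle.
Variables (R : realType) (n : nat).

Definition coord_partial (m : nat) (N : charted R m) (c : cidx N) (k : 'I_m)
    (u : N) : C^oo N -> R^o :=
  fun f => partial k (local_rep c f) (cmap c u).

Variable M : manifold R n.

Lemma local_repE (c : cidx M) (f : M -> R) x : cdom c x ->
  local_rep c f (cmap c x) = f x.
Proof.
move=> cx; rewrite /local_rep; case: pselect => [h|[]]; last by exists x.
case: cid2 => y cy yx /=; have [[_ inj _ _] _] := manifoldP M.
by rewrite (inj c y x) // inE.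
Qed.

Lemma coord_partial_derivation (c : cidx M) k (x : M) : cdom c x ->
  point_derivation x (coord_partial c k x).
Proof.
move=> cx; have [[_ _ /(_ c) op _] _] := manifoldP M.
have ox : (cimage c setT)° (cmap c x).
  have cT : cimage c setT = cimage c (cdom c) by rewrite /cimage setIT setIid.
  by rewrite cT; apply: open_nbhs_nbhs; split=> //; exists x.
have df (f : C^oo M) :
    derivable (local_rep c f) (cmap c x) (delta_mx 0 k : 'rV[R]_n).
  by have /asboolP/(_ c 1)[_ /(_ k)[+ _]] := smooth_valP f; exact.
apply/asboolP; split=> [a f g|f g]; rewrite /coord_partial /partial.
  have -> : local_rep c (a *: f + g) = a *: local_rep c f + local_rep c g.
    apply/funext=> z; rewrite !fctE /local_rep; case: pselect => // _.
    by rewrite scaler0 addr0.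
  by rewrite deriveD ?deriveZ//; exact: derivableZ.
rewrite (_ : local_rep c (f * g) = local_rep c f * local_rep c g).
  by rewrite deriveM// !local_repE.
exact: local_repM.
Qed.

(* d/dx^k at x, used only for x in the domain of c: see coord_vecE *)
Definition coord_vec (c : cidx M) (k : 'I_n) (x : M) : tangent x :=
  insubd (0 : tangent x) (coord_partial c k x).

Lemma coord_vecE (c : cidx M) k (x : M) : cdom c x ->
  coord_vec c k x = coord_partial c k x :> (C^oo M -> R^o).
Proof.
by move=> cx; rewrite -[LHS]/(val _) insubdK//; exact: coord_partial_derivation.
Qed.

(* T*_x M is the dual of the space of tangent vectors at x. *)
Record slit_point := SlitPoint {
  base : M;
  momentum : {linear tangent base -> R^o};
  momentum_neq0 : exists w, momentum w <> 0 }.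

(* induced coordinates (x^i, p_i), with p_i = p (d/dx^i) *)
Definition slit_cotangent : charted R (n + n) :=
  @Charted R (n + n) slit_point (cidx M)
    (fun c => [set u | cdom c (base u)])
    (fun c u => row_mx (cmap c (base u))
       (\row_(i < n) momentum u (coord_vec c i (base u)))).

(* the span of the d/dp_i at u; the p_i are the last n coordinates *)
Definition vertical (u : slit_cotangent) : set (tangent u) :=
  [set w | exists (c : cidx slit_cotangent) (a : 'I_n -> R), cdom c u /\
     forall f, w f = \sum_(i < n) a i * coord_partial c (rshift n i) u f].

End CotangentBundle.
Arguments vertical {R n M} u.

Section Tensors.
Variables (R : realType) (m : nat) (N : charted R m).
Implicit Types (X Y rho : vfield N) (u : N).

Definition has_dim (V : lmodType R) (d : nat) (S : set V) : Prop :=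
  exists b : 'I_d -> V,
    (forall a : 'I_d -> R, \sum_i a i *: b i = 0 -> forall i, a i = 0) /\
    S = [set v | exists a : 'I_d -> R, v = \sum_i a i *: b i].

(* (1,1)-tensor fields are the C^oo(N)-linear endomorphisms of the module of
   vector fields; im_at and ker_at are the image and the kernel of the
   induced endomorphism of the tangent space at u. *)
Definition im_at (L : vfield N -> vfield N) u : set (tangent u) :=
  [set w | exists X, w = at_point (L X) u].

Definition ker_at (L : vfield N -> vfield N) u : set (tangent u) :=
  [set w | exists X, w = at_point X u /\ at_point (L X) u = 0].

Definition lie_derivative rho (L : vfield N -> vfield N) : vfield N -> vfield N :=
  fun X => bracket rho (L X) - L (bracket rho X).

Definition half : C^oo N := smooth_const N 2^-1.

(* (Id + Nl)/2 and (Id - Nl)/2, which are projectors once Nl o Nl = Id *)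
Definition hproj (Nl : vfield N -> vfield N) X : vfield N := half *: (X + Nl X).
Definition vproj (Nl : vfield N -> vfield N) X : vfield N := half *: (X - Nl X).

Definition is_regular (J : vfield N -> vfield N) rho : Prop :=
  forall X, J (bracket rho (J X)) = - J X.

Definition canonical_connection (J : vfield N -> vfield N) rho :
    vfield N -> vfield N :=
  fun X => - lie_derivative rho J X.

Definition horizontal (Nl : vfield N -> vfield N) X : Prop :=
  hproj Nl X = X /\ vproj Nl X = 0.

(* action of a derivation on functions and on vector fields; on_tensors below
   gives its action on all tensor fields *)
Record cov_derivative := CovDerivative {
  on_functions : C^oo N -> C^oo N;
  on_vfields : vfield N -> vfield N }.

Definition dynamical_derivative rho (Nl : vfield N -> vfield N) :
    cov_derivative :=
  let h := hproj Nl in let v := vproj Nl in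
  CovDerivative rho
    (fun X => h (bracket rho (h X)) + v (bracket rho (v X))).

Definition berwald (J : vfield N -> vfield N) rho (Nl : vfield N -> vfield N) X :
    cov_derivative :=
  let h := hproj Nl in let v := vproj Nl in
  let F := fun Z => h (lie_derivative rho h Z) - J Z in
  CovDerivative X
    (fun Y => v (bracket (h X) (v Y)) + h (bracket (v X) (h Y)) +
              J (bracket (v X) (F Y + J Y)) +
              (F (bracket (h X) (J Y)) + J (bracket (h X) (J Y)))).

Definition is_form (om : vfield N -> C^oo N) : Prop :=
  forall (f : C^oo N) X Y, om (f *: X + Y) = f * om X + om Y.

Definition update (T : Type) (k : nat) (s : 'I_k -> T) (i : 'I_k) (t : T) :
    'I_k -> T :=
  fun j => if j == i then t else s j.

(* A tensor field of type (r, s) is a C^oo(N)-multilinear map taking r one-forms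
   and s vector fields to a function.  It is represented by a map defined on
   arbitrary maps om i : vfield N -> C^oo N, whose values matter only when
   every om i is a one-form. *)
Definition tensor_map (r s : nat) : Type :=
  ('I_r -> vfield N -> C^oo N) -> ('I_s -> vfield N) -> C^oo N.

Definition is_tensor (r s : nat) (T : tensor_map r s) : Prop :=
  forall om, (forall i, is_form (om i)) -> forall X : 'I_s -> vfield N,
    (forall i (f : C^oo N) al be, is_form al -> is_form be ->
       T (update om i (fun Y => f * al Y + be Y)) X =
       f * T (update om i al) X + T (update om i be) X) /\
    (forall j (f : C^oo N) Y Z,
       T om (update X j (f *: Y + Z)) =
       f * T om (update X j Y) + T om (update X j Z)).

Definition on_forms (d : cov_derivative) (om : vfield N -> C^oo N) :
    vfield N -> C^oo N :=
  fun X => on_functions d (om X) - om (on_vfields d X).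

(* the extension to tensor fields as a type-preserving derivation commuting with
   contractions *)
Definition on_tensors (d : cov_derivative) (r s : nat) (T : tensor_map r s) :
    tensor_map r s :=
  fun om (X : 'I_s -> vfield N) => on_functions d (T om X)
    - \sum_(i < r) T (update om i (on_forms d (om i))) X
    - \sum_(j < s) T om (update X j (on_vfields d (X j))).

End Tensors.
Arguments im_at {R m N} L u.
Arguments ker_at {R m N} L u.


Definition adapted_almost_tangent (R : realType) (n : nat) (M : manifold R n)
    (J : {linear vfield (slit_cotangent M) -> vfield (slit_cotangent M)}) :
    Prop :=
  (forall X, J (J X) = 0) /\
  (forall u, [/\ has_dim n (im_at J u), im_at J u = vertical u &
                 ker_at J u = vertical u]).

(* Main.v *)
From HB Require Import structures.
Require Import Defs.
From mathcomp Require Import all_boot all_order all_algebra.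
From mathcomp Require Import all_classical all_reals all_analysis.
From mathcomp Require Import ring.
Import GRing.Theory.
Local Open Scope ring_scope.

(** Write [lie] for the bracket with rho.  Since rho is horizontal, every term
    of the Berwald derivative D_rho Y containing v rho vanishes, which leaves
    v (lie (v Y)) + (F + J) (lie (J Y)), where F + J is h composed with the Lie
    derivative of h.  The theorem is thus the identity
    (F + J) (lie (J Y)) = h (lie (h Y)) ([berwald_horizontal_term]).  It is a
    computation with projectors: (F + J) Z = - h (lie (v Z)), while
    lie (J Y) = J (lie Y) - N Y has vertical part J (lie Y) + v Y, and
    h (lie (J Z)) = - h Z for all Z.  On other tensor fields there is nothing
    left to prove, because the extension of a derivation depends only on its
    action on functions and on vector fields.

    The computation uses N o N = Id.  This follows from N W = - W for all W in
    the kernel of J, because J (N X - X) = 0.  On the image of J the equation is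
    the regularity of rho, but J is only known to have equal kernel and image
    at each point.  To pass from tangent vectors to fields one would usually
    choose local frames and extend them by bump functions.  Here the argument is
    algebraic instead ([kernel_local_image]).  Given u, there are n fields J X_i
    and n functions t_j such that the function D = det (J X_i t_j) is nonzero
    at u, since the image of J at u has dimension n.  At every point the n + 1
    vectors W, J X_1, ..., J X_n lie in the n-dimensional image of J, so the
    determinant of their values on t_1, ..., t_n, s is zero for every s.
    Expanded along the column of s, it says that D W is, up to signs, a
    combination of the J X_i with globally smooth coefficients.  Hence
    D W = J Y for some field Y.  As N is linear over functions,
    D (N W + W) = N (J Y) + J Y = 0, and N W + W vanishes at u. *)

Set Implicit Arguments.
Unset Strict Implicit.
Unset Printing Implicit Defensive.

(** * Determinants of values of functionals *)

Section Evaluation.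
Variables (K : comPzRingType) (T : Type).

Definition eval_mx n (b : 'I_n -> T -> K) (t : 'I_n -> T) : 'M[K]_n :=
  \matrix_(i, j) b i (t j).

Definition append n (t : 'I_n -> T) (s : T) : 'I_n.+1 -> T :=
  fun j => if unlift ord_max j is Some k then t k else s.

(** The coefficients of the expansion along the last column do not involve s:
    a determinant that vanishes for all s is therefore a linear relation between
    the functionals themselves. *)
Lemma det_eval_append n (b : 'I_n.+1 -> T -> K) (t : 'I_n -> T) s :
  \det (eval_mx b (append t s)) = \sum_(i < n.+1)
    (-1) ^+ (i + n)%N * \det (eval_mx (fun k => b (lift i k)) t) * b i s.
Proof.
rewrite (expand_det_col _ ord_max); apply: eq_bigr => i _.
rewrite !mxE /append unlift_none mulrC /cofactor; congr (_ * \det _ * _).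
by apply/matrixP=> k j; rewrite !mxE liftK.
Qed.

End Evaluation.

(** By induction: if t already separates all functionals but the last one, and
    no further point s gives a nonzero determinant, then the expansion in s is a
    relation in which the last functional has a nonzero coefficient. *)
Lemma eval_mx_neq0 (K : fieldType) (T : Type) n (b : 'I_n -> T -> K) :
  (forall a : 'I_n -> K, (forall s, \sum_i a i * b i s = 0) ->
     forall i, a i = 0) ->
  exists t, \det (eval_mx b t) != 0.
Proof.
elim: n b => [|n IH] b free_b.
  (* the determinant of the empty matrix is 1 *)
  have t : 'I_0 -> T by case.
  by exists t; rewrite det_mx00 oner_neq0.
have [a ab0 i|t t_neq0] := IH (fun k => b (lift ord_max k)).
  pose a' (j : 'I_n.+1) := if unlift ord_max j is Some k then a k else 0.
  have <- : a' (lift ord_max i) = a i by rewrite /a' liftK.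
  apply: free_b => s; rewrite (bigD1_ord ord_max) //=.
  rewrite {1}/a' unlift_none mul0r add0r.
  by rewrite -[RHS](ab0 s); apply: eq_bigr => k _; rewrite /a' liftK.
apply: contrapT => all0; case/negP: t_neq0; apply/eqP.
suff /free_b/(_ ord_max) : forall s, \sum_(i < n.+1)
    (-1) ^+ (i + n)%N * \det (eval_mx (fun k => b (lift i k)) t) * b i s = 0.
  by rewrite /= -signr_odd addnn odd_double mul1r.
move=> s; rewrite -det_eval_append; apply: contrapT => /eqP nz.
by apply: all0; exists (append t s).
Qed.

(** The matrix factors through dimension n, so it has rank at most n. *)
Lemma eval_mx_span (K : fieldType) (T : Type) n (e : 'I_n -> T -> K)
    (b : 'I_n.+1 -> T -> K) (t : 'I_n.+1 -> T) :
  (forall i, exists a : 'I_n -> K, forall s, b i s = \sum_k a k * e k s) ->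
  \det (eval_mx b t) = 0.
Proof.
move=> /choice[a be].
have -> : eval_mx b t = (\matrix_(i, k) a i k) *m (\matrix_(k, j) e k (t j)).
  by apply/matrixP=> i j; rewrite !mxE be; apply: eq_bigr => k _; rewrite !mxE.
apply/eqP; apply: contraT; rewrite -unitfE -unitmxE -row_full_unit /row_full.
move=> /eqP rk; have := mxrankM_maxl (\matrix_(i, k) a i k)
  (\matrix_(k, j) e k (t j)).
by rewrite rk => /leq_trans/(_ (rank_leq_col _)); rewrite ltnn.
Qed.

(** * Vector fields and brackets *)

Section VectorFields.
Variables (R : realType) (m : nat) (N : charted R m).
Implicit Types (f g : C^oo N) (X Y Z rho : vfield N) (u : N).

Lemma smooth_ext f g : (forall u, f u = g u) -> f = g.
Proof. by move=> fg; apply/val_inj/funext. Qed.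

Lemma vfield_ext X Y : (forall f, X f = Y f) -> X = Y.
Proof. by move=> XY; apply/val_inj/funext. Qed.

(** Evaluation at a point is named because it is a ring morphism, and so
    commutes with determinants of smooth functions. *)
Definition ev u (f : C^oo N) : R := f u.

Lemma ev_zmod_morphism u : zmod_morphism (ev u).
Proof. by []. Qed.
Lemma ev_monoid_morphism u : monoid_morphism (ev u).
Proof. by []. Qed.
HB.instance Definition _ u :=
  GRing.isZmodMorphism.Build (C^oo N) R (ev u) (ev_zmod_morphism u).
HB.instance Definition _ u :=
  GRing.isMonoidMorphism.Build (C^oo N) R (ev u) (ev_monoid_morphism u).

Lemma vfieldD X f g : X (f + g) = X f + X g.
Proof. by have := vfield_linear X 1 f g; rewrite !scale1r. Qed.

Lemma vfield0 X : X 0 = 0.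
Proof. by apply: (addrI (X 0)); rewrite -vfieldD !addr0. Qed.

Lemma bracketE X Y f : bracket X Y f = X (Y f) - Y (X f).
Proof. by []. Qed.

Lemma bracketD rho X Y : bracket rho (X + Y) = bracket rho X + bracket rho Y.
Proof.
by apply: vfield_ext => g; rewrite !(vfield_addE, bracketE) vfieldD; ring.
Qed.

Lemma bracketr0 rho : bracket rho 0 = 0.
Proof. by apply: (addrI (bracket rho 0)); rewrite -bracketD !addr0. Qed.

Lemma bracketN rho X : bracket rho (- X) = - bracket rho X.
Proof.
by apply: (addrI (bracket rho X)); rewrite -bracketD !subrr bracketr0.
Qed.

Lemma bracketB rho X Y : bracket rho (X - Y) = bracket rho X - bracket rho Y.
Proof. by rewrite bracketD bracketN. Qed.

Lemma bracketZ rho f X : bracket rho (f *: X) = f *: bracket rho X + rho f *: X.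
Proof.
apply: vfield_ext => g.
rewrite !(vfield_addE, vfield_scaleE, bracketE) vfield_leibniz; ring.
Qed.

Lemma bracket0l X : bracket 0 X = 0.
Proof. by apply: vfield_ext => g; rewrite bracketE vfield0 subrr. Qed.

Lemma vfield_sumE n (X : 'I_n -> vfield N) f :
  (\sum_i X i) f = \sum_i X i f.
Proof. by elim/big_ind2: _ => // Y a Z b <- <-. Qed.

Lemma tangent_sumE n u (a : 'I_n -> R) (w : 'I_n -> tangent u) f :
  (\sum_i a i *: w i) f = \sum_i a i * w i f.
Proof.
rewrite -[RHS]/(\sum_i (a i *: w i) f).
by elim/big_ind2: _ => // v a' v' b <- <-.
Qed.

Lemma halfD X : Defs.half N *: X + Defs.half N *: X = X.
Proof.
rewrite -scalerDl -[RHS]scale1r; congr (_ *: _); apply: smooth_ext => u.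
by rewrite smooth_addE [RHS](Num.Theory.splitr 1) mul1r.
Qed.

End VectorFields.

(** * From the kernel to the image of a tensor field *)

Section LocalImage.
Variables (R : realType) (m : nat) (N : charted R m).
Variable J : {linear vfield N -> vfield N}.
Variable n : nat.
Hypothesis dim_im : forall u, has_dim n (im_at J u).
Hypothesis ker_im : forall u, ker_at J u = im_at J u.

(** At the points where D is nonzero, W is the image of the field Y / D; since
    denominators are cleared, Y is defined everywhere and no extension of local
    fields is involved. *)
Lemma kernel_local_image W u : J W = 0 ->
  exists (D : C^oo N) Y, D u <> 0 /\ D *: W = J Y.
Proof.
move=> JW0; have [b [free_b imE]] := dim_im u.
have /choice[X bX] : forall i, exists X, b i = at_point (J X) u.
  move=> i; have : im_at J u (b i); last by [].
  rewrite imE; exists (fun k => (k == i)%:R).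
  rewrite (bigD1 i) //= eqxx scale1r big1 ?addr0 // => k /negbTE ->.
  by rewrite scale0r.
have [a ab0 i|t t_neq0] := @eval_mx_neq0 R (C^oo N) n (fun i f => J (X i) f u).
  apply: free_b; apply/val_inj/funext => f; rewrite -[RHS](ab0 f).
  rewrite -[LHS]/((\sum_i a i *: b i) f) tangent_sumE.
  by apply: eq_bigr => k _; rewrite bX.
pose B := append (fun i => J (X i)) W.
pose c (i : 'I_n.+1) :=
    (-1) ^+ (i + n)%N * \det (eval_mx (fun k f => B (lift i k) f) t).
(* the coefficient of W in this relation is det (J X_i t_j) *)
have cB0 : \sum_i c i *: B i = 0.
  apply: vfield_ext => s; rewrite vfield_sumE.
  rewrite -[LHS](det_eval_append (fun i f => B i f)).
  apply: smooth_ext => y; rewrite -[LHS]/(ev y _) -det_map_mx.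
  have [e [_ imEy]] := dim_im y.
  have -> : map_mx (ev y) (eval_mx (fun i f => B i f) (append t s)) =
            eval_mx (fun i f => B i f y) (append t s).
    by apply/matrixP=> i j; rewrite !mxE.
  apply: (@eval_mx_span _ _ _ (fun k f => e k f)) => i.
  have : im_at J y (at_point (B i) y).
    rewrite /B /append; case: unlift => [k|]; first by exists (X k).
    rewrite -ker_im; exists W; split=> //; rewrite JW0.
    by apply/val_inj/funext.
  rewrite imEy => -[a Ba]; exists a => f; rewrite -tangent_sumE -Ba //.
exists (c ord_max), (- \sum_i c (lift ord_max i) *: X i); split.
  rewrite /c /= -signr_odd addnn odd_double mul1r -[X in X <> _]/(ev u _).
  rewrite -det_map_mx; apply/eqP; move: t_neq0; congr (\det _ != 0).
  by apply/matrixP=> i j; rewrite !mxE /B /append liftK.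
rewrite linearN linear_sum; apply/eqP; rewrite -addr_eq0; apply/eqP.
rewrite -[RHS]cB0 (bigD1_ord ord_max) //= {1}/B /append unlift_none.
by congr (_ + _); apply: eq_bigr => i _; rewrite linearZ /B /append liftK.
Qed.

End LocalImage.

(** * The canonical nonlinear connection *)

Section RegularField.
Variables (R : realType) (m : nat) (N : charted R m).
Variable J : {linear vfield N -> vfield N}.
Variable rho : vfield N.
Implicit Types (f : C^oo N) (X Y Z : vfield N).
Hypothesis JJ : forall X, J (J X) = 0.
Hypothesis reg : is_regular J rho.

Local Notation Nl := (canonical_connection J rho).
Local Notation h := (hproj Nl).
Local Notation v := (vproj Nl).
Local Notation lie := (bracket rho).

Lemma connectionE X : Nl X = J (lie X) - lie (J X).
Proof. by rewrite /canonical_connection /lie_derivative opprB. Qed.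

Lemma bracket_J X : lie (J X) = J (lie X) - Nl X.
Proof. by rewrite connectionE opprB addrC subrK. Qed.

Lemma connectionD X Y : Nl (X + Y) = Nl X + Nl Y.
Proof. by rewrite !connectionE linearD !bracketD linearD opprD addrACA. Qed.

Lemma connectionZ f X : Nl (f *: X) = f *: Nl X.
Proof.
rewrite !connectionE linearZ !bracketZ linearD !linearZ /=.
by rewrite opprD addrACA subrr addr0 scalerBr.
Qed.

Lemma connectionN X : Nl (- X) = - Nl X.
Proof. by rewrite -scaleN1r connectionZ scaleN1r. Qed.

Lemma J_connection X : J (Nl X) = J X.
Proof. by rewrite connectionE linearB /= JJ reg sub0r opprK. Qed.

(** The regularity of rho says that N = - Id on the image of J.  As N is linear
    over functions, D (N W + W) = 0 as soon as D W is in that image, and D can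
    be divided out at u. *)
Lemma connection_ker_local W u :
  (exists (D : C^oo N) Y, D u <> 0 /\ D *: W = J Y) ->
  forall f, (Nl W + W) f u = 0.
Proof.
move=> [D [Y [Du DW]]] f.
have : D *: (Nl W + W) = 0.
  rewrite scalerDr -connectionZ DW connectionE JJ bracketr0 subr0 reg.
  by rewrite addNr.
move/(congr1 (fun X : vfield N => X f u)); rewrite vfield_scaleE smooth_mulE.
by move/eqP; rewrite mulf_eq0 => /orP[/eqP/Du|/eqP].
Qed.

Hypothesis connection_ker : forall X, J X = 0 -> Nl X = - X.

(** J cannot distinguish N X from X, so N X - X is in the kernel of J, on which
    N is - Id. *)
Lemma connectionK X : Nl (Nl X) = X.
Proof.
have /connection_ker : J (Nl X - X) = 0.
  by rewrite linearB /= J_connection subrr.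
rewrite connectionD connectionN opprB => /(canRL (subrK _)).
by rewrite subrK.
Qed.

Lemma hvD X : h X + v X = X.
Proof.
by rewrite /hproj /vproj -scalerDr addrACA subrr addr0 scalerDr halfD.
Qed.

Lemma hvB X : h X - v X = Nl X.
Proof.
by rewrite /hproj /vproj -scalerBr opprB addrC addrA subrK scalerDr halfD.
Qed.

Lemma hD X Y : h (X + Y) = h X + h Y.
Proof. by rewrite /hproj connectionD addrACA scalerDr. Qed.

Lemma hN X : h (- X) = - h X.
Proof. by rewrite /hproj connectionN -opprD scalerN. Qed.

Lemma h_idem X : h (h X) = h X.
Proof.
by rewrite {1}/hproj connectionZ connectionD connectionK [Nl X + X]addrC halfD.
Qed.

Lemma h_ker X : J X = 0 -> h X = 0.
Proof. by move=> JX; rewrite /hproj connection_ker // subrr scaler0. Qed.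

(** lie (J X) differs from - N X by an element of the image of J, which h kills,
    and h o N = h. *)
Lemma h_bracket_J X : h (lie (J X)) = - h X.
Proof.
rewrite bracket_J hD hN h_ker ?JJ // sub0r; congr (- _).
by rewrite /hproj connectionK addrC.
Qed.

(** As h is idempotent, h (lie (h Z)) - h (h (lie Z)) = h (lie (h Z - Z)). *)
Lemma h_lie_h Z : h (lie_derivative rho h Z) = - h (lie (v Z)).
Proof.
rewrite /lie_derivative hD hN h_idem -{2}(hvD Z) bracketD hD.
by rewrite opprD addrA subrr add0r.
Qed.

(** The last term of the Berwald derivative is the horizontal part of the
    dynamical derivative: the vertical part of lie (J Y) is J (lie Y) + v Y, and
    - h (lie (J (lie Y))) gives back h (lie Y), from which h (lie (v Y)) is
    subtracted. *)
Lemma berwald_horizontal_term Y :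
  h (lie_derivative rho h (lie (J Y))) = h (lie (h Y)).
Proof.
rewrite h_lie_h.
have -> : v (lie (J Y)) = J (lie Y) + v Y.
  apply: (addrI (h (lie (J Y)))); rewrite hvD h_bracket_J addrCA bracket_J.
  by rewrite -(hvB Y) opprB [v Y - _]addrC.
rewrite bracketD hD h_bracket_J opprD opprK -hN -hD -bracketB.
by congr (h (lie _)); rewrite -{1}(hvD Y) addrK.
Qed.
End RegularField.

Theorem theorem1 (R : realType) (n : nat) (M : manifold R n)
    (J : {linear vfield (slit_cotangent M) -> vfield (slit_cotangent M)})
    (rho : vfield (slit_cotangent M)) :
  adapted_almost_tangent J ->
  is_regular J rho ->
  let Nl := canonical_connection J rho in
  let nabla := dynamical_derivative rho Nl in
  let D := berwald J rho Nl in
  horizontal Nl rho ->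
  [/\ forall f : C^oo (slit_cotangent M),
        on_functions nabla f = on_functions (D rho) f,
      forall X : vfield (slit_cotangent M),
        on_vfields nabla X = on_vfields (D rho) X &
      forall (r s : nat) (T : tensor_map (slit_cotangent M) r s),
        is_tensor T ->
        forall om, (forall i, is_form (om i)) ->
        forall X, on_tensors nabla T om X = on_tensors (D rho) T om X].
Proof.
move=> [JJ adapted] reg Nl nabla D [h_rho v_rho].
have dim_im u : has_dim n (im_at J u) by have [] := adapted u.
have ker_im u : ker_at J u = im_at J u by have [_ -> ->] := adapted u.
have connection_ker X : J X = 0 -> Nl X = - X.
  move=> JX0; apply/eqP; rewrite -addr_eq0; apply/eqP/vfield_ext => f.
  apply: smooth_ext => u; apply: connection_ker_local => //.
  exact: (kernel_local_image dim_im).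
suff -> : nabla = D rho by [].
congr CovDerivative; apply/funext => Y.
rewrite h_rho v_rho !bracket0l linear0 addr0.
rewrite [hproj Nl 0]h_ker ?linear0 // addr0.
rewrite subrK.
rewrite (berwald_horizontal_term JJ) //.
by rewrite addrC.
Qed.
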